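(* The set $\mathcal{DNM}$ of all differentiable nowhere monotone functions, i.e. functions $f:[0,1]\to\mathbb{R}$ that are differentiable and are not monotone on any interval $[a,b]\subseteq[0,1]$ with $a<b$, is strongly $\mathfrak{c}$-algebrable (as a subset of the algebra $\mathbb{R}^{[0,1]}$).
   Context: $\mathfrak{c}=2^{\omega}$ is the cardinality of the continuum. $\mathbb{R}^{[0,1]}$ is the real commutative algebra of all functions $[0,1]\to\mathbb{R}$ with pointwise operations. A subset $S$ of a commutative real algebra $\mathcal{L}$ is strongly $\kappa$-algebrable if $S\cup\{0\}$ contains a $\kappa$-generated algebra isomorphic to a free (commutative, non-unital) algebra; equivalently, there is a set $X\subseteq\mathcal{L}$ of cardinality $\kappa$ such that for every $k\ge 1$, every nonzero real polynomial $P$ in $k$ variables without constant term and all distinct $y_1,\dots,y_k\in X$, we have $P(y_1,\dots,y_k)\neq 0$ and $P(y_1,\dots,y_k)\in S$. *)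

(* Defs.v *)
From HB Require Import structures.
From mathcomp Require Import all_boot all_order all_algebra.
From mathcomp Require Import all_classical all_reals all_analysis.
From mathcomp Require Import unstable.
From mathcomp Require mpoly.
(* The notations of mpoly and of mathcomp-analysis cannot be loaded together;
   [mpoly k R] is the type {mpoly R[k]}. *)
Import -(notations) mpoly.
Import Order.TTheory GRing.Theory Num.Theory.
Import numFieldNormedType.Exports.

Set Implicit Arguments.
Unset Strict Implicit.
Unset Printing Implicit Defensive.

Local Open Scope classical_set_scope.
Local Open Scope ring_scope.

(* mathcomp-analysis makes T -> R a commutative ring and an R-module under the
   pointwise operations, but not an R-algebra. *)
Section FunctionAlgebra.
Variables (T : pointedType) (R : realType).

Let scalerAl_fun (a : R) (f g : T -> R) :
  a *: (f * g : T -> R) = (a *: f : T -> R) * g.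
Proof. by apply/funext => x; exact: mulrA. Qed.

HB.instance Definition _ :=
  GRing.Lmodule_isLalgebra.Build R (T -> R) scalerAl_fun.
HB.instance Definition _ := GRing.Lalgebra_isComAlgebra.Build R (T -> R).

End FunctionAlgebra.

Definition unit_interval (R : realType) : Type := set_type `[0 : R, 1].

Section UnitInterval.
Variable R : realType.

HB.instance Definition _ := SubChoice.on (unit_interval R).
HB.instance Definition _ :=
  [SubChoice_isSubOrder of unit_interval R by <: with ring_display].
HB.instance Definition _ := Topological.on (unit_interval R).

Let in01_0 : (0 : R) \in (`[0, 1]%classic : set R).
Proof. by rewrite inE /= in_itv /= lexx ler01. Qed.

HB.instance Definition _ := isPointed.Build (unit_interval R) (exist _ 0 in01_0).

End UnitInterval.

Definition algebra_eval (R : realType) (L : comAlgType R) (k : nat)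
    (y : 'I_k -> L) (P : mpoly k R) : L :=
  mmap (in_alg L) y P.

(* The cardinal kappa is given by a set K of that cardinality. The polynomials
   have no constant term because the free algebra is non-unital. *)
Definition strongly_algebrable (R : realType) (L : comAlgType R)
    (U : Type) (K : set U) (S : set L) : Prop :=
  exists X : set L, (X #= K)%card /\
    forall (k : nat) (P : mpoly k R) (y : 'I_k -> L),
      (0 < k)%N -> P != 0 -> mcoeff mnm0 P = 0 ->
      injective y -> (forall i, X (y i)) ->
      algebra_eval y P != 0 /\ S (algebra_eval y P).

Definition continuum : set (nat -> bool) := [set: nat -> bool].

(* x^' is the punctured neighbourhood filter in the subspace topology of [0, 1],
   so the derivative is one-sided at the end points. *)
Definition differentiable01 (R : realType) (f : unit_interval R -> R) : Prop :=
  forall x : unit_interval R,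
    cvg ((f y - f x) / (val y - val x : R) @[y --> x^']).

Definition nowhere_monotone (R : realType) (f : unit_interval R -> R) : Prop :=
  forall a b : unit_interval R, (a < b)%O -> ~ monotonic `[a, b] f.

Definition DNM (R : realType) : set (unit_interval R -> R) :=
  [set f | differentiable01 f /\ nowhere_monotone f].

(* Main.v *)
From HB Require Import structures.
Require Import Defs.
From mathcomp Require Import all_boot all_order all_algebra.
From mathcomp Require Import all_classical all_reals all_analysis.
From mathcomp Require Import ring lra zify.
From mathcomp Require mpoly.
Import -(notations) mpoly.
Import Order.TTheory GRing.Theory Num.Theory.
Import numFieldNormedType.Exports.

Set Implicit Arguments.
Unset Strict Implicit.
Unset Printing Implicit Defensive.

Local Open Scope classical_set_scope.
Local Open Scope ring_scope.

(** Everything is obtained from one differentiable function f on the line whose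
    derivative takes both signs on every open interval.

    Such an f is a series of cube roots read in a new coordinate.  Let cbrt be the
    cube root, whose graph has a vertical tangent at 0, and let y be an injective
    sequence whose even-indexed and odd-indexed terms are both dense.  With
    positive weights a_n decreasing fast enough, put
      g(u) = u + sum_n a_n cbrt(u - y_n),
      G(u) = sum_n (-1)^n 2^-n a_n cbrt(u - y_n),
    ([stretch] and [wiggle] below) and f = G o g^-1.  The function g is an
    increasing homeomorphism of the line with infinite slope at every y_n.  A
    difference quotient of f has the form
      (G(v) - G(u)) / (g(v) - g(u)) = sum_n (-1)^n 2^-n r_n,
    where the share r_n, which lies in [0, 1], is the part that the n-th term
    contributes to the increment of g.  Each share has a limit as v tends to u:
    either g has a finite slope at u and one differentiates termwise, or it has an
    infinite slope and every term of finite slope has share tending to 0.  At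
    u = y_m only the m-th term has an infinite slope, hence takes the whole
    increment.  Tannery's theorem exchanges limit and sum, so f is differentiable
    everywhere and f'(g(y_m)) = (-1)^m 2^-m, which is positive for even m and
    negative for odd m ([oscillating_exists]).

    The free generators are the functions exp(b f), where b runs over continuum
    many real numbers that are linearly independent over the integers.  These
    frequencies are sums of reciprocal factorials over the codes of the prefixes
    of a binary sequence: distinct sequences share finitely many prefixes, and an
    integral relation would give a convergent factorial series with bounded
    integral digits and sum 0, whose digits eventually vanish by the argument that
    proves e irrational ([frequency_indep]).

    A polynomial P without constant term evaluated at such generators is phi o f,
    where phi is a combination of exponentials with distinct nonzero exponents.
    By linear independence of exponentials phi' vanishes on no interval, and f is
    continuous and nowhere constant, so in every interval there is a smaller one
    on which phi' o f has a constant sign; there the derivative of phi o f, which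
    is (phi' o f) f', takes both signs ([oscillating_comp]).  Thus phi o f is
    differentiable and nowhere monotone, and in particular is not zero. *)

(** * Dominated series *)

Section Series.
Variable R : realType.
Implicit Types u v M l : R^nat.

Lemma near_punctured (u : R) : \forall v \near u^', v != u.
Proof. exact: nbhs_dnbhs_neq. Qed.

Lemma cvg_series_dominated u M :
  (forall n, `|u n| <= M n) -> cvgn (series M) -> cvgn (series u).
Proof.
move=> uM cM; apply: normed_cvg; apply: series_le_cvg cM => n //=.
exact: le_trans (uM n).
Qed.

Lemma series_tail_dominated u M N :
  (forall n, `|u n| <= M n) -> cvgn (series M) ->
  `|limn (series u) - series u N| <= limn (series M) - series M N.
Proof.
move=> uM cM; have cu := cvg_series_dominated uM cM.
have M0 n : 0 <= M n by exact: le_trans (uM n).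
have ndM : nondecreasing_seq (series M).
  apply/nondecreasing_seqP => n.
  by rewrite seriesEnat /= big_nat_recr //= lerDl.
have cN : `|series u k - series u N| @[k --> \oo] -->
    `|limn (series u) - series u N|.
  by apply: cvg_norm; apply: cvgB => //; exact: cvg_cst.
rewrite -(cvg_lim _ cN) //; apply: limr_le.
  by apply/cvg_ex; eexists; exact: cN.
near=> k; have Nk : (N <= k)%N by near: k; exists N.
rewrite sub_series_geq // (le_trans (ler_norm_sum _ _ _)) //.
rewrite (@le_trans _ _ (series M k - series M N)) //.
  by rewrite sub_series_geq //; apply: ler_sum.
by rewrite lerD2r; exact: nondecreasing_cvgn_le.
Unshelve. all: end_near. Qed.

(** Tannery's theorem: dominated convergence for series. *)
Lemma tannery T (F : set_system T) (FF : ProperFilter F) (u : nat -> T -> R) l M :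
  (forall n, u n t @[t --> F] --> l n) -> cvgn (series M) ->
  (\forall t \near F, forall n, `|u n t| <= M n) ->
  limn (series (u^~ t)) @[t --> F] --> limn (series l).
Proof.
move=> ul cM uM.
have lM n : `|l n| <= M n.
  rewrite -(cvg_lim _ (cvg_norm (ul n))) //; apply: limr_le.
    by apply/cvg_ex; eexists; exact: cvg_norm (ul n).
  by near=> t; move: n; near: t.
apply/cvgrPdist_le => e e0.
have e30 : 0 < e / 3 by lra.
have [N _ /(_ N (leqnn _)) MN] := (cvgrPdist_le _ _).1 cM _ e30.
have cN : series (u^~ t) N @[t --> F] --> series l N.
  by apply: cvg_big => //; exact: add_continuous.
near=> t.
have h1 : `|series l N - series (u^~ t) N| <= e / 3.
  by near: t; exact: (cvgrPdist_le _ _).1 cN _ e30.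
have h2 : `|limn (series (u^~ t)) - series (u^~ t) N| <=
    limn (series M) - series M N.
  by apply: series_tail_dominated => //; near: t.
have h3 := series_tail_dominated N lM cM.
move: h1 h2 h3 MN; rewrite !ler_norml; lra.
Unshelve. all: end_near. Qed.

Lemma cvg_series_half (C : R) : cvgn (series (fun n => C * 2^-1 ^+ n)).
Proof.
apply: is_cvg_geometric_series; rewrite ger0_norm ?invr_ge0 //.
by rewrite invf_lt1 // ltr1n.
Qed.

End Series.
Arguments cvg_series_half {R} C.

(** * The cube root *)

Section CubeRoot.
Variable R : realType.
Implicit Types u v : R.

Definition cbrt u : R := Num.sg u * `|u| `^ (3^-1).

Lemma cbrtK u : cbrt u ^+ 3 = u.
Proof.
rewrite /cbrt exprMn -(powR_mulrn _ (powR_ge0 _ _)) -powRrM.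
rewrite mulVf ?pnatr_eq0 // powRr1 //; have [->|u0|u0] := sgrP u; by ring.
Qed.

Lemma cbrt_eq0 u : (cbrt u == 0) = (u == 0).
Proof. by rewrite -[in RHS](cbrtK u) expf_eq0. Qed.

Lemma cbrt0 : cbrt 0 = 0.
Proof. by apply/eqP; rewrite cbrt_eq0. Qed.

(** The reciprocal of the slope of the chord of [cbrt] between u and v. *)
Definition cbrt_form u v := cbrt u ^+ 2 + cbrt u * cbrt v + cbrt v ^+ 2.

Lemma cbrtB u v : (cbrt v - cbrt u) * cbrt_form u v = v - u.
Proof. by rewrite -[in RHS](cbrtK u) -[in RHS](cbrtK v) /cbrt_form; ring. Qed.

(** Since a^2 + ab + b^2 is at least 3/4 a^2, every chord from u has slope at most
    4 times the slope of the tangent at u.  This is the domination that allows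
    series of cube roots to be differentiated termwise. *)
Lemma cbrt_form_lower u v : 3 / 4 * cbrt u ^+ 2 <= cbrt_form u v.
Proof.
have -> : cbrt_form u v = 3 / 4 * cbrt u ^+ 2 + (cbrt v + cbrt u / 2) ^+ 2.
  by rewrite /cbrt_form; field.
by rewrite lerDl sqr_ge0.
Qed.

Lemma cbrt_form_gt0 u v : v != u -> 0 < cbrt_form u v.
Proof.
move=> vu; rewrite lt_neqAle (le_trans _ (cbrt_form_lower u v)) ?andbT.
  by apply/eqP => q0; move: vu; rewrite -subr_eq0 -cbrtB -q0 mulr0 eqxx.
by rewrite mulr_ge0 ?sqr_ge0 //; lra.
Qed.

Lemma cbrt_slope u v : v != u ->
  (cbrt v - cbrt u) / (v - u) = (cbrt_form u v)^-1.
Proof.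
move=> vu; rewrite -(cbrtB u v) invfM mulrA divff ?mul1r //.
by apply: contra_neq vu => q0; apply/eqP; rewrite -subr_eq0 -cbrtB q0 mul0r.
Qed.

Lemma cbrt_dist u v : `|cbrt v - cbrt u| ^+ 3 <= 4 * `|v - u|.
Proof.
rewrite -(cbrtB u v) normrM exprS [X in _ <= X]mulrCA ler_wpM2l // -normrX.
rewrite (ger0_norm (sqr_ge0 _)).
have q0 : 0 <= cbrt_form u v.
  by apply: le_trans (cbrt_form_lower u v); rewrite mulr_ge0 ?sqr_ge0 //; lra.
rewrite ger0_norm // -subr_ge0 /cbrt_form.
have -> : 4 * (cbrt u ^+ 2 + cbrt u * cbrt v + cbrt v ^+ 2) -
    (cbrt v - cbrt u) ^+ 2 = 3 * (cbrt u + cbrt v) ^+ 2 by ring.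
by rewrite mulr_ge0 ?sqr_ge0.
Qed.

Lemma cbrt_continuous : continuous cbrt.
Proof.
move=> u; apply/cvgrPdist_le => e e0; near=> v.
rewrite -(@ler_pXn2r _ 3%N) ?nnegrE //; last exact: ltW.
apply: le_trans (cbrt_dist _ _) _.
rewrite mulrC -ler_pdivlMr //.
by near: v; apply: cvgr_dist_le => //; rewrite divr_gt0 ?exprn_gt0.
Unshelve. all: end_near. Qed.

Lemma ler_norm_cbrt u : `|cbrt u| <= 1 + `|u|.
Proof.
rewrite -[in X in _ <= X](cbrtK u) normrX; set t := `|_|.
have t0 : 0 <= t by exact: normr_ge0.
have [t1|/ltW t1] := leP t 1; first by rewrite (le_trans t1) // lerDl exprn_ge0.
by rewrite (@le_trans _ _ (t ^+ 3)) ?lerDr // -[X in X <= _]expr1 ler_weXn2l.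
Qed.
End CubeRoot.

(** * A sequence with two dense halves *)

Section BicoloredSequence.
Variable R : realType.

Lemma itv_avoid (l : seq R) (a b : R) :
  a < b -> exists2 x, a < x < b & x \notin l.
Proof.
elim: l a b => [|c l IH] a b ab.
  by exists ((a + b) / 2); rewrite ?in_nil //; lra.
(* One of the two halves of the interval does not contain c. *)
have [cm|cm] := ltP c ((a + b) / 2).
  have /IH [x xab xl] : (a + b) / 2 < b by lra.
  exists x; first lra.
  by rewrite inE negb_or xl andbT; apply/eqP => xc; lra.
have /IH [x xab xl] : a < (a + b) / 2 by lra.
exists x; first lra.
by rewrite inE negb_or xl andbT; apply/eqP => xc; lra.
Qed.

(** The terms are chosen one after the other, each avoiding the finite history of
    the previous choices. *)
Lemma injective_selection (a b : nat -> R) : (forall n, a n < b n) ->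
  exists2 y : nat -> R, injective y & forall n, a n < y n < b n.
Proof.
move=> ab.
have /choice [pick pickP] : forall ln : seq R * nat,
    exists x, a ln.2 < x < b ln.2 /\ x \notin ln.1.
  by move=> [l n]; have [x ? ?] := itv_avoid l (ab n); exists x.
pose hist := fix hist n :=
  if n is m.+1 then pick (hist m, m) :: hist m else [::].
pose y n := pick (hist n, n).
have yh m n : (m < n)%N -> y m \in hist n.
  elim: n => // n IH; rewrite ltnS leq_eqVlt => /predU1P[->|/IH].
    by rewrite inE eqxx.
  by rewrite inE => ->; rewrite orbT.
have yne m n : (m < n)%N -> y m != y n.
  move=> /yh ymn; have [_] := pickP (hist n, n).
  by apply: contraNneq; rewrite -/(y n) => <-.
exists y => [m n /eqP ymn|n]; last by have [] := pickP (hist n, n).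
by have [/yne|/yne|//] := ltngtP m n; rewrite ?ymn // eq_sym ymn.
Qed.

(** Each interval with rational end points is prescribed for two consecutive
    indices, so that the terms of either parity are dense. *)
Lemma dense_bicolored_sequence : exists2 y : nat -> R, injective y &
  forall a b, a < b -> exists n, a < y n.*2 < b /\ a < y n.*2.+1 < b.
Proof.
(* The interval ]0, 1[ stands in when n./2 does not encode an interval. *)
pose I n : R * R := if unpickle n./2 is Some (p, q) then
  (if p < q :> rat then (ratr p, ratr q) else (0, 1)) else (0, 1).
have IP n : (I n).1 < (I n).2.
  rewrite /I; case: unpickle => [[p q]|] /=; last exact: ltr01.
  by case: ifP => /= [|_]; [rewrite ltr_rat | exact: ltr01].
have [y yinj yI] := injective_selection IP.
exists y => // a b ab.
have [p /[!in_itv]/= /andP[ap pb]] := rat_in_itvoo ab.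
have [q /[!in_itv]/= /andP[pq qb]] := rat_in_itvoo pb.
have IE n : n./2 = pickle (p, q) -> I n = (ratr p, ratr q).
  by move=> E; rewrite /I E pickleK -(ltr_rat R) pq.
exists (pickle (p, q)).
have := yI (pickle (p, q)).*2; have := yI (pickle (p, q)).*2.+1.
by rewrite (IE _ (doubleK _)) (IE _.*2.+1 (uphalf_double _)) /= => ? ?; lra.
Qed.
End BicoloredSequence.

(** * A signed series of cube roots in a stretched coordinate *)

Section Construction.
Variables (R : realType) (y : nat -> R).

(** The term 1 + |y_n| of the denominator makes the series of cube roots converge
    at every point; the sum makes the weighted slopes summable at every y_m, since
    a slope of the n-th term at y_m is taken into account as soon as m < n. *)
Definition weight n : R :=
  2^-1 ^+ n / (1 + `|y n| + \sum_(m < n) (cbrt (y n - y m) ^+ 2)^-1).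

Let past_slopes n := \sum_(m < n) (cbrt (y n - y m) ^+ 2)^-1.

Let past_slopes_ge0 n : 0 <= past_slopes n.
Proof. by apply: sumr_ge0 => i _; rewrite invr_ge0 sqr_ge0. Qed.

Let den_gt0 n : 0 < 1 + `|y n| + past_slopes n.
Proof. by have := past_slopes_ge0 n; have := normr_ge0 (y n); lra. Qed.

Let half_gt0 n : 0 < 2^-1 ^+ n :> R.
Proof. by rewrite exprn_gt0. Qed.

Lemma weight_gt0 n : 0 < weight n.
Proof. by rewrite divr_gt0. Qed.

Lemma weight_le n (t : R) :
  t <= 1 + `|y n| + past_slopes n -> weight n * t <= 2^-1 ^+ n.
Proof.
move=> tS; rewrite /weight -mulrA ler_piMr ?(ltW (half_gt0 n)) //.
by rewrite mulrC ler_pdivrMr ?mul1r.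
Qed.

(** For n > m the choice of the weights bounds the terms by 2^-n; the term n = m is
    0 because the inverse of 0 is 0 here. *)
Lemma cvg_weighted_slopes m :
  cvgn (series (fun n => weight n * (cbrt (y m - y n) ^+ 2)^-1)).
Proof.
pose M n : R :=
  if (n <= m)%N then weight n * (cbrt (y m - y n) ^+ 2)^-1 else 0.
apply: (@cvg_series_dominated _ _ (fun n => M n + 1 * 2^-1 ^+ n)); last first.
  apply: is_cvg_seriesD; last exact: cvg_series_half.
  rewrite -(is_cvg_series_restrict m.+1); apply/cvg_ex; exists 0.
  apply: cvg_near_cst; near=> k.
  rewrite /= big_nat big1 // => i /andP[mi _].
  by rewrite /M leqNgt mi.
move=> n /=.
have n0 : 0 <= (cbrt (y m - y n) ^+ 2)^-1 by rewrite invr_ge0 sqr_ge0.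
rewrite ger0_norm; last by rewrite mulr_ge0 // ltW // weight_gt0.
rewrite /M mul1r.
case: leqP => [_|mn]; first by rewrite lerDl (ltW (half_gt0 n)).
rewrite add0r; apply: weight_le.
have -> : cbrt (y m - y n) ^+ 2 = cbrt (y n - y m) ^+ 2.
  rewrite -(opprB (y n)); move: (y n - y m) => t.
  by rewrite /cbrt sgrN normrN mulNr sqrrN.
have : (cbrt (y n - y m) ^+ 2)^-1 <= past_slopes n.
  rewrite /past_slopes (bigD1 (Ordinal mn)) //= lerDl.
  by apply: sumr_ge0 => i _; rewrite invr_ge0 sqr_ge0.
by have := normr_ge0 (y n); lra.
Unshelve. all: end_near. Qed.

Definition term n u := weight n * cbrt (u - y n).
Definition stretch u := u + limn (series (term^~ u)).

Lemma term_le n u : `|term n u| <= (1 + `|u|) * 2^-1 ^+ n.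
Proof.
rewrite /term normrM (ger0_norm (ltW (weight_gt0 n))).
have h : `|cbrt (u - y n)| <= (1 + `|u|) * (1 + `|y n|).
  apply: le_trans (ler_norm_cbrt _) _; have := ler_normB u (y n).
  have : 0 <= `|u| * `|y n| by rewrite mulr_ge0.
  by nra.
apply: le_trans (ler_wpM2l (ltW (weight_gt0 n)) h) _.
rewrite mulrCA ler_wpM2l //.
by apply: weight_le; have := past_slopes_ge0 n; lra.
Qed.

Lemma cvg_terms u : cvgn (series (term^~ u)).
Proof.
apply: (cvg_series_dominated _ (cvg_series_half (1 + `|u|))) => n.
exact: term_le.
Qed.
Arguments cvg_terms : clear implicits.

Lemma cvg_increments u v : cvgn (series (fun n => term n v - term n u)).
Proof. exact: (is_cvg_seriesB (cvg_terms v) (cvg_terms u)). Qed.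
Arguments cvg_increments : clear implicits.

Lemma stretchB u v :
  stretch v - stretch u =
  (v - u) + limn (series (fun n => term n v - term n u)).
Proof.
rewrite /stretch -[in RHS]/((term^~ v) - (term^~ u)) lim_seriesB;
  by [ring | exact: cvg_terms].
Qed.

Definition slope n u v := (term n v - term n u) / (v - u).

Lemma slopeE n u v : v != u ->
  slope n u v = weight n / cbrt_form (u - y n) (v - y n).
Proof.
move=> vu; rewrite /slope /term -mulrBr -mulrA; congr (_ * _).
by rewrite -cbrt_slope ?(inj_eq (addIr _)) //; congr (_ / _); ring.
Qed.

Lemma slope_ge0 n u v : v != u -> 0 <= slope n u v.
Proof.
move=> vu; rewrite slopeE // divr_ge0 ?(ltW (weight_gt0 _)) //.
by rewrite ltW // cbrt_form_gt0 // (inj_eq (addIr _)).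
Qed.

Lemma slope_le n u v : u != y n -> v != u ->
  slope n u v <= 4 / 3 * (weight n * (cbrt (u - y n) ^+ 2)^-1).
Proof.
move=> uy vu; rewrite slopeE // mulrCA ler_wpM2l ?(ltW (weight_gt0 _)) //.
have c0 : 0 < cbrt (u - y n) ^+ 2.
  by rewrite exprn_even_gt0 //= cbrt_eq0 subr_eq0.
rewrite -[4 / 3]invrK -invfM lef_pV2 ?posrE.
- by apply: le_trans (cbrt_form_lower _ _); rewrite invf_div.
- by rewrite cbrt_form_gt0 // (inj_eq (addIr _)).
- by rewrite mulr_gt0 // invr_gt0; lra.
Qed.

Lemma cvg_slopes u v : cvgn (series (fun n => slope n u v)).
Proof.
rewrite (_ : (fun n => slope n u v) =
  (v - u)^-1 *: (fun n => term n v - term n u)).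
  by apply: is_cvg_seriesZ; exact: cvg_increments.
by apply/funext => n; rewrite /slope mulrC.
Qed.
Arguments cvg_slopes : clear implicits.

Lemma stretch_slope u v : v != u ->
  (stretch v - stretch u) / (v - u) = 1 + limn (series (fun n => slope n u v)).
Proof.
move=> vu; rewrite stretchB mulrDl divff ?subr_eq0 //; congr (_ + _).
rewrite mulrC -[LHS]/(_ *: _) -lim_seriesZ; last exact: cvg_increments.
by congr (limn (series _)); apply/funext => n; rewrite /slope mulrC.
Qed.

Lemma partial_slopes_le u v N : v != u ->
  series (fun n => slope n u v) N <= limn (series (fun n => slope n u v)).
Proof.
move=> vu; apply: nondecreasing_cvgn_le; last exact: cvg_slopes.
apply/nondecreasing_seqP => n.
by rewrite seriesEnat /= big_nat_recr //= lerDl slope_ge0.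
Qed.

Lemma stretch_slope_ge1 u v : v != u -> 1 <= (stretch v - stretch u) / (v - u).
Proof.
move=> vu; rewrite stretch_slope // lerDl.
by have := partial_slopes_le 0 vu; rewrite seriesEnat /= big_geq.
Qed.

Lemma stretch_slope_ge n u v : v != u ->
  slope n u v <= (stretch v - stretch u) / (v - u).
Proof.
move=> vu; rewrite stretch_slope //.
have := partial_slopes_le n.+1 vu; rewrite seriesEnat /= big_nat_recr //=.
have : 0 <= \sum_(0 <= i < n) slope i u v.
  by apply: sumr_ge0 => i _; exact: slope_ge0.
lra.
Qed.

Lemma stretch_increment u v : u < v -> v - u <= stretch v - stretch u.
Proof.
move=> uv; have vu0 : 0 < v - u by rewrite subr_gt0.
have /stretch_slope_ge1 : v != u by rewrite gt_eqF.
by rewrite ler_pdivlMr // mul1r.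
Qed.

Lemma stretch_expanding u v : `|v - u| <= `|stretch v - stretch u|.
Proof.
have [uv|vu|->] := ltgtP u v; last by rewrite !subrr.
  have h := stretch_increment uv; rewrite !ger0_norm //; lra.
have h := stretch_increment vu.
rewrite !(distrC v) !(distrC (stretch v)) !ger0_norm //; lra.
Qed.

Lemma stretch_inj : injective stretch.
Proof.
move=> u v E; have := stretch_expanding u v.
by rewrite E subrr normr0 normr_le0 subr_eq0 => /eqP.
Qed.

Lemma stretch_continuous : continuous stretch.
Proof.
move=> u; apply: cvgD; first exact: cvg_id.
apply: (@tannery _ _ (nbhs u) _ (fun n v => term n v) (term^~ u)
  (fun n => (1 + (1 + `|u|)) * 2^-1 ^+ n)).
- move=> n; apply: cvgM; first exact: cvg_cst.
  apply: (@continuous_comp _ _ _ (fun v => v - y n) (@cbrt R)).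
    by apply: cvgB; [exact: cvg_id|exact: cvg_cst].
  exact: cbrt_continuous.
- exact: cvg_series_half.
- near=> v => n; apply: le_trans (term_le n v) _.
  rewrite ler_wpM2r ?(ltW (half_gt0 n)) //.
  rewrite lerD2l -lerBlDr (le_trans (lerB_dist _ _)) //.
Unshelve. all: end_near. Qed.

Lemma stretch_surj x : exists u, stretch u = x.
Proof.
pose b := `|x| + `|stretch 0| + 1.
have b0 : 0 < b.
  by have := normr_ge0 x; have := normr_ge0 (stretch 0); rewrite /b; lra.
have h1 := stretch_increment b0.
have h2 : 0 - - b <= stretch 0 - stretch (- b) by apply: stretch_increment; lra.
have /andP[? ?] : - `|x| <= x <= `|x| by rewrite -ler_norml.
have /andP[? ?] : - `|stretch 0| <= stretch 0 <= `|stretch 0|.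
  by rewrite -ler_norml.
have [|||u _ <-] := @IVT _ stretch (- b) b x; last by exists u.
- lra.
- exact/continuous_subspaceT/stretch_continuous.
- rewrite ge_min le_max; apply/andP; split; apply/orP; [left|right];
    by rewrite /b in h1 h2 *; lra.
Qed.

Lemma slope_cvg n u : u != y n ->
  slope n u v @[v --> u^'] --> weight n / (3 * cbrt (u - y n) ^+ 2).
Proof.
move=> uy; have c0 : cbrt (u - y n) != 0 by rewrite cbrt_eq0 subr_eq0.
have E : 3 * cbrt (u - y n) ^+ 2 = cbrt_form (u - y n) (u - y n).
  by rewrite /cbrt_form; ring.
rewrite E.
have h : weight n / cbrt_form (u - y n) (v - y n) @[v --> u] -->
    weight n / cbrt_form (u - y n) (u - y n).
  apply: cvgM; first exact: cvg_cst.
  apply: cvgV; first by rewrite -E mulf_neq0 ?expf_neq0.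
  have cc : cbrt (v - y n) @[v --> u] --> cbrt (u - y n).
    apply: (@continuous_comp _ _ _ (fun v => v - y n) (@cbrt R)).
      by apply: cvgB; [exact: cvg_id|exact: cvg_cst].
    exact: cbrt_continuous.
  apply: cvgD; last by apply: cvgM.
  by apply: cvgD; [exact: cvg_cst | apply: cvgM => //; exact: cvg_cst].
have {}h : weight n / cbrt_form (u - y n) (v - y n) @[v --> u^'] -->
    weight n / cbrt_form (u - y n) (u - y n) by exact: cvg_within_filter h.
apply: cvg_trans h; apply: near_eq_cvg.
by near=> v; rewrite slopeE //; near: v; exact: near_punctured.
Unshelve. all: end_near. Qed.

Lemma slope_pole n : slope n (y n) v @[v --> (y n)^'] --> +oo.
Proof.
apply/cvgryPge => A.
pose e := weight n / (1 + `|A|).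
have A0 : 0 < 1 + `|A| by have := normr_ge0 A; lra.
have e0 : 0 < e by rewrite divr_gt0 ?weight_gt0.
have cc : cbrt (v - y n) ^+ 2 @[v --> y n] --> (0 : R).
  rewrite -[X in _ --> X](expr0n _ 2) /= -[X in X ^+ _]cbrt0.
  rewrite -[X in cbrt X](subrr (y n)).
  apply: (@continuous_comp _ _ _ (fun v => cbrt (v - y n)) (fun t => t ^+ 2));
    last exact: exprn_continuous.
  apply: (@continuous_comp _ _ _ (fun v => v - y n) (@cbrt R)).
    by apply: cvgB; [exact: cvg_id|exact: cvg_cst].
  exact: cbrt_continuous.
have {}cc : cbrt (v - y n) ^+ 2 @[v --> (y n)^'] --> (0 : R).
  exact: cvg_within_filter cc.
near=> v.
have vy : v != y n by near: v; exact: near_punctured.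
rewrite slopeE // subrr /cbrt_form cbrt0 mul0r expr0n /= !add0r.
have c0 : 0 < cbrt (v - y n) ^+ 2.
  by rewrite exprn_even_gt0 //= cbrt_eq0 subr_eq0.
have ce : cbrt (v - y n) ^+ 2 <= e.
  near: v; apply: filterS ((cvgrPdist_le _ _).1 cc _ e0) => v /=.
  by rewrite sub0r normrN ger0_norm ?sqr_ge0.
rewrite ler_pdivlMr // (@le_trans _ _ (`|A| * cbrt (v - y n) ^+ 2)) //.
  by rewrite ler_wpM2r ?(ltW c0) // ler_norm.
apply: le_trans (ler_wpM2l (normr_ge0 A) ce) _.
rewrite /e mulrA ler_pdivrMr // mulrC.
rewrite ler_wpM2l ?(ltW (weight_gt0 _)) //; lra.
Unshelve. all: end_near. Qed.

(** The slope of [stretch] always has a limit, finite or infinite, and the inverse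
    of the slope is used because it has a finite limit in either case.  If the
    tangent slopes of the terms are summable, the limit is finite by domination;
    if they are not, finite partial sums already make it infinite; at y_n it is
    infinite because of the n-th term alone. *)
Lemma inverse_slope_cvg u : exists2 k,
  (v - u) / (stretch v - stretch u) @[v --> u^'] --> k &
  forall n, u = y n -> k = 0.
Proof.
have inv (v : R) : (v - u) / (stretch v - stretch u) =
    ((stretch v - stretch u) / (v - u))^-1.
  by rewrite invf_div.
have big : ((stretch v - stretch u) / (v - u)) @[v --> u^'] --> +oo ->
    (v - u) / (stretch v - stretch u) @[v --> u^'] --> (0 : R).
  move=> h; under eq_cvg do rewrite inv.
  apply/gtr0_cvgV0 => //; near=> v.
  apply: lt_le_trans ltr01 (stretch_slope_ge1 _).
  by near: v; exact: near_punctured.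
have [[n uy]|nuy] := pselect (exists n, u = y n).
  exists 0 => //; apply: big.
  have := slope_pole n; rewrite -uy; apply: ger_cvgy.
  near=> v; apply: stretch_slope_ge; near: v; exact: near_punctured.
have uy n : u != y n by apply/eqP => E; apply: nuy; exists n.
pose d n := weight n / (3 * cbrt (u - y n) ^+ 2).
have d_ge0 n : 0 <= d n.
  rewrite divr_ge0 //; first exact/ltW/weight_gt0.
  by rewrite mulr_ge0 // sqr_ge0.
have [cd|dd] := pselect (cvgn (series d)).
  exists (1 + limn (series d))^-1; last by move=> n E; case: nuy; exists n.
  under eq_cvg do rewrite inv.
  have d0 : 0 <= limn (series d).
    by apply: limr_ge => //; apply: nearW => n; exact: sumr_ge0.
  apply: cvgV; first by rewrite gt_eqF //; lra.
  have h : limn (series (fun n => slope n u v)) @[v --> u^'] --> limn (series d).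
    apply: (@tannery _ _ _ _ (fun n v => slope n u v) d (4 *: d)).
    - by move=> n; exact: slope_cvg.
    - exact: is_cvg_seriesZ.
    - near=> v => n; have vu : v != u by near: v; exact: near_punctured.
      rewrite ger0_norm ?slope_ge0 //; apply: le_trans (slope_le (uy n) vu) _.
      rewrite le_eqVlt; apply/orP; left; apply/eqP.
      rewrite -[RHS]/(4 * d n) /d; field.
      by rewrite cbrt_eq0 subr_eq0.
  have {}h : 1 + limn (series (fun n => slope n u v)) @[v --> u^'] -->
      1 + limn (series d) by apply: cvgD => //; exact: cvg_cst.
  apply: cvg_trans h; apply: near_eq_cvg; near=> v.
  by rewrite stretch_slope //; near: v; exact: near_punctured.
exists 0; last by move=> n E; case: nuy; exists n.
apply: big; apply/cvgryPge => A.
have nd : nondecreasing_seq (series d).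
  apply/nondecreasing_seqP => n.
  by rewrite seriesEnat /= big_nat_recr //= lerDl d_ge0.
have [N AN] : exists N, A < series d N.
  have [//|/forallNP hA] := pselect (exists N, A < series d N).
  case: dd; apply: nondecreasing_is_cvgn => //.
  by exists A => _ [N _ <-]; rewrite leNgt; apply/negP; exact: hA.
have cN : series (fun n => slope n u v) N @[v --> u^'] --> series d N.
  by apply: cvg_big => [|n _]; [exact: add_continuous | exact: slope_cvg].
near=> v; have vu : v != u by near: v; exact: near_punctured.
rewrite stretch_slope // (@le_trans _ _ (series (fun n => slope n u v) N)) //.
  by near: v; exact: (cvgr_ge _ cN).
by rewrite (le_trans (partial_slopes_le N vu)) // lerDr.
Unshelve. all: end_near. Qed.

Definition share n u v := (term n v - term n u) / (stretch v - stretch u).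

Lemma shareE n u v : v != u ->
  share n u v = slope n u v * ((v - u) / (stretch v - stretch u)).
Proof. by move=> vu; rewrite /share /slope mulrA divfK ?subr_eq0. Qed.

Lemma share_ge0 n u v : v != u -> 0 <= share n u v.
Proof.
move=> vu; rewrite shareE // mulr_ge0 ?slope_ge0 // -invf_div invr_ge0.
exact: le_trans ler01 (stretch_slope_ge1 vu).
Qed.

Lemma share_le1 n u v : v != u -> share n u v <= 1.
Proof.
move=> vu; rewrite shareE // -invf_div.
rewrite ler_pdivrMr ?mul1r ?stretch_slope_ge //.
exact: lt_le_trans ltr01 (stretch_slope_ge1 vu).
Qed.

Hypothesis y_inj : injective y.

(** At y_m every term but the m-th has a finite slope, and by the choice of the
    weights these slopes have a finite sum. *)
Lemma rest_bounded m : exists K, forall v, v != y m ->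
  1 + limn (series (fun n => slope n (y m) v)) - slope m (y m) v <= K.
Proof.
pose M n := 4 / 3 * (weight n * (cbrt (y m - y n) ^+ 2)^-1).
have cM : cvgn (series M).
  by apply: (@is_cvg_seriesZ _ _ (4 / 3)); exact: cvg_weighted_slopes.
exists (1 + limn (series M)) => v vy.
rewrite -addrA lerD2l lerBlDr.
(* The m-th slope is moved to the right-hand side as a series with one term. *)
have c1 : cvgn (series (fun n => (n == m)%:R * slope m (y m) v)).
  rewrite -(is_cvg_series_restrict m.+1); apply/cvg_ex; exists 0.
  apply: cvg_near_cst; near=> k.
  rewrite /= big_nat big1 // => i /andP[mi _].
  by rewrite gtn_eqF // mul0r.
have l1 :
    limn (series (fun n => (n == m)%:R * slope m (y m) v)) = slope m (y m) v.
  apply: cvg_lim => //; apply: cvg_near_cst; near=> k.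
  rewrite seriesEnat /= (bigD1_seq m) ?mem_index_iota ?iota_uniq //=;
    last by near: k; exists m.+1.
  by rewrite eqxx mul1r big1 ?addr0 // => i /negbTE->; rewrite mul0r.
rewrite -[X in _ <= _ + X]l1 -lim_seriesD //; apply: lim_series_le => //.
- exact: cvg_slopes.
- exact: is_cvg_seriesD.
move=> n; rewrite -[leRHS]/(M n + (n == m)%:R * slope m (y m) v).
have [->|nm] := eqVneq n m.
  by rewrite mul1r lerDr /M subrr cbrt0 expr0n /= invr0 !mulr0.
rewrite mul0r addr0; apply: slope_le => //.
by apply: contra_neq nm => /y_inj.
Unshelve. all: end_near. Qed.

(** If u is not y_n, the n-th term has a finite slope and [inverse_slope_cvg]
    applies.  At u = y_n, the share is 1 up to a bounded slope divided by the slope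
    of [stretch], which tends to infinity. *)
Lemma share_cvg n u : exists2 l, share n u v @[v --> u^'] --> l &
  forall m, u = y m -> l = (n == m)%:R.
Proof.
have [k kc k0] := inverse_slope_cvg u.
have [uy|uy] := eqVneq u (y n).
  exists 1; last by move=> m; rewrite uy => /y_inj ->; rewrite eqxx.
  have [K hK] := rest_bounded n.
  have {}k0 := k0 _ uy; rewrite k0 in kc.
  have h : 1 - K * ((v - u) / (stretch v - stretch u)) @[v --> u^'] --> (1 : R).
    rewrite -[X in _ --> X](subr0 (1 : R)) -[X in 1 - X](mulr0 K).
    apply: cvgB; first exact: cvg_cst.
    by apply: cvgM => //; exact: cvg_cst.
  apply: (squeeze_cvgr _ h (cvg_cst _)); near=> v.
  have vu : v != u by near: v; exact: near_punctured.
  rewrite share_le1 // andbT shareE //.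
  rewrite lerBlDr -mulrDl -invf_div ler_pdivlMr ?mul1r; last first.
    exact: lt_le_trans ltr01 (stretch_slope_ge1 vu).
  rewrite stretch_slope //; have := hK v; rewrite -uy => /(_ vu); lra.
exists (weight n / (3 * cbrt (u - y n) ^+ 2) * k).
  have h : slope n u v * ((v - u) / (stretch v - stretch u)) @[v --> u^'] -->
    weight n / (3 * cbrt (u - y n) ^+ 2) * k by exact: cvgM (slope_cvg uy) kc.
  apply: cvg_trans h; apply: near_eq_cvg.
  by near=> v; rewrite shareE //; near: v; exact: near_punctured.
move=> m um; rewrite (k0 _ um) mulr0; case: eqP => // nm.
by rewrite um nm eqxx in uy.
Unshelve. all: end_near. Qed.

Definition wiggle u :=
  limn (series (fun n => (-1) ^+ n * 2^-1 ^+ n * term n u)).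

Lemma cvg_wiggle u : cvgn (series (fun n => (-1) ^+ n * 2^-1 ^+ n * term n u)).
Proof.
apply: (cvg_series_dominated _ (cvg_series_half (1 + `|u|))) => n.
apply: le_trans (term_le n u).
rewrite !normrM normrX normrN1 expr1n mul1r ler_piMl //.
by rewrite normrX exprn_ile1 // ger0_norm ?invr_ge0 // invf_le1 // ler1n.
Qed.

Lemma wiggle_ratio_cvg u : exists2 L,
  (wiggle v - wiggle u) / (stretch v - stretch u) @[v --> u^'] --> L &
  forall m, u = y m -> L = (-1) ^+ m * 2^-1 ^+ m.
Proof.
have /choice [l lP] n : exists l, share n u v @[v --> u^'] --> l /\
    forall m, u = y m -> l = (n == m)%:R.
  by have [l ? ?] := share_cvg n u; exists l.
exists (limn (series (fun n => (-1) ^+ n * 2^-1 ^+ n * l n))).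
  have h : limn (series (fun n => (-1) ^+ n * 2^-1 ^+ n * share n u v))
      @[v --> u^'] --> limn (series (fun n => (-1) ^+ n * 2^-1 ^+ n * l n)).
    apply: (@tannery _ _ _ _
      (fun n v => (-1) ^+ n * 2^-1 ^+ n * share n u v) _
      (fun n => 1 * 2^-1 ^+ n)).
    - by move=> n; apply: cvgM; [exact: cvg_cst | have [] := lP n].
    - exact: cvg_series_half.
    - near=> v => n; have vu : v != u by near: v; exact: near_punctured.
      rewrite normrM (ger0_norm (share_ge0 n vu)) normrM normrX normrN1.
      rewrite expr1n !mul1r ger0_norm ?exprn_ge0 ?invr_ge0 //.
      by rewrite ler_piMr ?exprn_ge0 ?invr_ge0 // share_le1.
  apply: cvg_trans h; apply: near_eq_cvg; near=> v.
  have vu : v != u by near: v; exact: near_punctured.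
  rewrite /wiggle -lim_seriesB; try exact: cvg_wiggle.
  rewrite mulrC -[RHS]/(_ *: _) -lim_seriesZ; last first.
    by apply: is_cvg_seriesB; exact: cvg_wiggle.
  congr (limn (series _)); apply/funext => n.
  rewrite /share -[RHS]/(_ * (_ * _ - _ * _)); ring.
move=> m um; apply: cvg_lim => //; apply: cvg_near_cst; near=> k.
rewrite seriesEnat /= (bigD1_seq m) ?mem_index_iota ?iota_uniq //=;
  last by near: k; exists m.+1.
have lE n : l n = (n == m)%:R by have [_ /(_ _ um)] := lP n.
rewrite lE eqxx mulr1 big1 ?addr0 // => i /negbTE im.
by rewrite lE im mulr0.
Unshelve. all: end_near. Qed.

End Construction.

(** * Functions whose derivative oscillates everywhere *)

Section Oscillating.
Variable R : realType.
Implicit Types (f phi : R -> R).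

Lemma slope_cvg_is_derive f (x L : R) :
  (f z - f x) / (z - x) @[z --> x^'] --> L -> is_derive x 1 f L.
Proof.
move=> h.
have sh : (h + x) @[h --> (0 : R)^'] --> x^'.
  have := @continuous_injective_withinNx _ _ (fun h : R => h + x) 0.
  rewrite add0r; apply.
    by apply: cvgD; [exact: cvg_id | exact: cvg_cst].
  by move=> y /(canRL (addrK x)); rewrite subrr.
have {}h : h^-1 *: ((f \o shift x) (h *: 1) - f x) @[h --> (0 : R)^'] --> L.
  have := cvg_comp _ _ sh h; apply: cvg_trans; apply: near_eq_cvg.
  by apply: nearW => t /=; rewrite addrK mulrC /GRing.scale /= mulr1.
apply: DeriveDef; first by apply/cvg_ex; exists L.
exact: cvg_lim.
Qed.

Lemma is_derive_slope_cvg f (x L : R) :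
  is_derive x 1 f L -> (f z - f x) / (z - x) @[z --> x^'] --> L.
Proof.
move=> [dfx <-].
have sh : (z - x) @[z --> x^'] --> (0 : R)^'.
  have := @continuous_injective_withinNx _ _ (fun z : R => z - x) x.
  rewrite subrr; apply.
    by apply: cvgB; [exact: cvg_id | exact: cvg_cst].
  by move=> y /eqP; rewrite subr_eq0 => /eqP.
have := cvg_comp _ _ sh dfx; apply: cvg_trans; apply: near_eq_cvg.
by apply: nearW => t /=; rewrite mulrC /GRing.scale /= mulr1 subrK.
Qed.

(** Unlike nowhere monotonicity, this property passes to composites by the chain
    rule. *)
Definition oscillating f :=
  (forall x : R, derivable f x 1) /\
  forall a b, a < b ->
    (exists2 x, a < x < b & 0 < derive1 f x) /\
    (exists2 x, a < x < b & derive1 f x < 0).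

Lemma oscillating_exists : exists f, oscillating f.
Proof.
have [y yinj yd] := dense_bicolored_sequence R.
have /choice [h hK] := stretch_surj y.
have Kh := inj_can_sym hK (@stretch_inj _ y).
have hc (x : R) : h z @[z --> x^'] --> (h x)^'.
  apply: continuous_injective_withinNx; last first.
    by move=> z E; rewrite -(hK z) E hK.
  apply/cvgrPdist_le => e e0; near=> z.
  apply: le_trans (stretch_expanding y (h z) (h x)) _; rewrite !hK.
  by near: z; apply: cvgr_dist_le.
pose f := wiggle y \o h.
have fd (x : R) : exists2 L, is_derive x 1 f L &
    forall m, h x = y m -> L = (-1) ^+ m * 2^-1 ^+ m.
  have [L wL yL] := wiggle_ratio_cvg yinj (h x); exists L => //.
  apply: slope_cvg_is_derive.
  have := cvg_comp _ _ (hc x) wL; apply: cvg_trans; apply: near_eq_cvg.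
  by apply: nearW => z; rewrite /= !hK.
have fy m : derive1 f (stretch y (y m)) = (-1) ^+ m * 2^-1 ^+ m.
  have [L dL /(_ m (Kh _)) <-] := fd (stretch y (y m)).
  by rewrite derive1E; exact: derive_val.
have stretch_lt u v : (stretch y u < stretch y v) = (u < v).
  have [uv|vu|->] := ltgtP u v; last by rewrite ltxx.
    by have := stretch_increment y uv; lra.
  by apply/negbTE; rewrite -leNgt; have := stretch_increment y vu; lra.
exists f; split=> [x|a b ab]; first by have [L [] ] := fd x.
have hab : h a < h b by rewrite -stretch_lt !hK.
have [n [y1 y2]] := yd _ _ hab.
have p0 k : 0 < 2^-1 ^+ k :> R by rewrite exprn_gt0.
split.
  exists (stretch y (y n.*2)); first by rewrite -(hK a) -(hK b) !stretch_lt.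
  by rewrite fy -signr_odd odd_double mul1r.
exists (stretch y (y n.*2.+1)); first by rewrite -(hK a) -(hK b) !stretch_lt.
by rewrite fy -signr_odd /= odd_double mulN1r oppr_lt0.
Unshelve. all: end_near. Qed.

Lemma derive_gt0_chord f (a b x : R) :
  derivable f x 1 -> a < x < b -> 0 < derive1 f x ->
  exists2 z, a < z < b & 0 < (f z - f x) / (z - x).
Proof.
move=> df axb f0.
have := is_derive_slope_cvg (derivableP df); rewrite -derive1E => h.
have /filter_ex [z [? ?]] :
    \forall z \near x^', a < z < b /\ 0 < (f z - f x) / (z - x).
  near=> z; split; last by near: z; exact: (cvgr_gt _ h).
  near: z; apply: nbhs_dnbhs.
  by apply: filterS (near_in_itvoo _) => [z|]; [rewrite in_itv | exact: axb].
by exists z.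
Unshelve. all: end_near. Qed.

Lemma derive_lt0_chord f (a b x : R) :
  derivable f x 1 -> a < x < b -> derive1 f x < 0 ->
  exists2 z, a < z < b & (f z - f x) / (z - x) < 0.
Proof.
move=> df axb f0.
have [|||z zab zf] := @derive_gt0_chord (- f) a b x;
  rewrite ?derive1N ?oppr_gt0 //; first exact: derivableN.
exists z => //; move: zf; rewrite -[(- f) z]/(- f z) -[(- f) x]/(- f x).
by rewrite -opprB opprK addrC -opprB mulNr oppr_gt0.
Qed.

(** An interval where f is not constant is mapped onto a set containing an
    interval, hence contains x0 where phi' o f is nonzero.  Near x0 the continuous
    function phi' o f keeps its sign, so that the derivative of the composite has
    the sign of f', or the opposite one, throughout. *)
Lemma oscillating_comp f phi : oscillating f ->
  (forall t : R, derivable phi t 1) -> continuous (derive1 phi) ->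
  (forall a b, a < b -> exists2 t, a < t < b & derive1 phi t != 0) ->
  oscillating (phi \o f).
Proof.
move=> [df fab] dphi cphi phi0.
have fphi (x : R) : is_derive x 1 (phi \o f) (derive1 phi (f x) * derive1 f x).
  by rewrite !derive1E; apply: is_derive1_comp; exact: derivableP.
have fphiE x : derive1 (phi \o f) x = derive1 phi (f x) * derive1 f x.
  by rewrite derive1E; exact: derive_val.
have cf : continuous f.
  by move=> x; exact/differentiable_continuous/derivable1_diffP.
split=> [x|a b ab]; first by case: (fphi x).
have [[c cab fc0] _] := fab _ _ ab.
have [z zab zc] := derive_gt0_chord (df c) cab fc0.
have fzc : f z != f c by apply: contraTneq zc => ->; rewrite subrr mul0r ltxx.
have [x0 x0ab px0] : exists2 x0, a < x0 < b & derive1 phi (f x0) != 0.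
  have mM : Num.min (f c) (f z) < Num.max (f c) (f z).
    by rewrite gt_min !lt_max !ltxx /= orbF; case: ltgtP fzc.
  have [t tm pt] := phi0 _ _ mM.
  pose p := Num.min c z; pose q := Num.max c z.
  have pq : p <= q by rewrite ge_min !le_max lexx.
  have [||x xpq xt] := @IVT _ f p q t pq; last 1 first.
  - exists x; last by rewrite xt.
    move: xpq; rewrite in_itv /= /p /q; case: (leP c z) => _; lra.
  - exact: continuous_subspaceT.
  - move: tm; rewrite /p /q; case: (leP c z) => _ /andP[h1 h2];
      rewrite ?(minC (f z)) ?(maxC (f z)); apply/andP; split; exact: ltW.
have cpf : continuous (derive1 phi \o f).
  by move=> x; apply: continuous_comp; [exact: cf | exact: cphi].
have [a' [b' [ab' sub sgn]]] : exists a' b', [/\ a' < b',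
    (forall x, a' < x < b' -> a < x < b) &
    forall x, a' < x < b' -> 0 < derive1 phi (f x0) * derive1 phi (f x)].
  have : \forall x \near x0,
      a < x < b /\ 0 < derive1 phi (f x0) * derive1 phi (f x).
    near=> x; split.
      near: x; apply: filterS (near_in_itvoo _) => [z0|]; last exact: x0ab.
      by rewrite in_itv.
    near: x.
    have h : derive1 phi (f x0) * derive1 phi (f x) @[x --> x0] -->
        derive1 phi (f x0) * derive1 phi (f x0).
      by apply: cvgM; [exact: cvg_cst | exact: cpf].
    by apply: (cvgr_gt _ h); rewrite -expr2 exprn_even_gt0.
  move=> /nbhs_ballP [e /= e0 be].
  have bx x : x0 - e < x < x0 + e -> ball x0 e x.
    by move=> xe; rewrite -ball_normE /= ltr_distlC; lra.
  by exists (x0 - e), (x0 + e); split; [lra | move=> x /bx /be[] ..].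
have [[u uab fu] [v vab fv]] := fab _ _ ab'.
move: (sgn _ uab) (sgn _ vab) => su sv.
have [p0|p0] := ltP 0 (derive1 phi (f x0)).
  rewrite !pmulr_rgt0 // in su sv.
  split; [exists u | exists v]; rewrite ?sub // fphiE ?mulr_gt0 //.
  by rewrite pmulr_rlt0.
have {}p0 : derive1 phi (f x0) < 0 by rewrite lt_neqAle px0.
rewrite !nmulr_rgt0 // in su sv.
split; [exists v | exists u]; rewrite ?sub // fphiE ?nmulr_rgt0 //.
by rewrite nmulr_rlt0.
Unshelve. all: end_near. Qed.

Lemma val_continuous : continuous (val : unit_interval R -> R).
Proof. exact: initial_continuous. Qed.

Lemma ltr_val (a b : unit_interval R) : (a < b)%O = (val a < val b).
Proof. exact: esym (lt_val a b). Qed.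

Lemma ler_val (a b : unit_interval R) : (a <= b)%O = (val a <= val b).
Proof. by rewrite !leNgt ltr_val. Qed.

Lemma oscillating_DNM f : oscillating f -> @DNM R (f \o val).
Proof.
move=> [df fab]; split.
  move=> x; have := is_derive_slope_cvg (derivableP (df (val x))).
  move=> h; apply/cvg_ex; eexists.
  have vx : val z @[z --> x^'] --> (val x)^'.
    apply: continuous_injective_withinNx; first exact: val_continuous.
    by move=> z /val_inj.
  exact: cvg_comp _ _ vx h.
move=> a b; rewrite ltr_val => ab.
have lift (t : R) : val a < t < val b ->
    exists2 u : unit_interval R, val u = t & u \in `[a, b].
  move=> /andP[at_ tb].
  have t01 : t \in `[0 : R, 1]%classic.
    have ha : 0 <= val a by have := set_valP a; rewrite /= in_itv => /andP[].
    have hb : val b <= 1 by have := set_valP b; rewrite /= in_itv => /andP[].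
    rewrite inE /= in_itv /=; lra.
  exists (exist _ t t01) => //; rewrite in_itv /= !ler_val.
  exact/andP/(conj (ltW at_) (ltW tb)).
have [[u uab fu] [v vab fv]] := fab _ _ ab.
have [u' u'ab fu'] := derive_gt0_chord (df u) uab fu.
have [v' v'ab fv'] := derive_lt0_chord (df v) vab fv.
have [U UE Uab] := lift _ uab; have [U' U'E U'ab] := lift _ u'ab.
have [V VE Vab] := lift _ vab; have [V' V'E V'ab] := lift _ v'ab.
subst u u' v v'.
(* A nondecreasing function has no descending chord, a nonincreasing one no
   ascending chord. *)
case=> mono.
  have h1 := mono V V' Vab V'ab; have h2 := mono V' V V'ab Vab.
  rewrite !ler_val /= in h1 h2; move: fv'.
  have [VV|VV] := leP (val V) (val V').
    by rewrite ltNge divr_ge0 ?subr_ge0 // h1.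
  by rewrite -mulrNN -invrN !opprB ltNge divr_ge0 ?subr_ge0 ?h2 ?ltW.
have h1 := mono U U' Uab U'ab; have h2 := mono U' U U'ab Uab.
rewrite !ler_val /= in h1 h2; move: fu'; rewrite ltNge -oppr_ge0.
have [UU|UU] := leP (val U) (val U').
  by rewrite -mulNr opprB divr_ge0 ?subr_ge0 // h2.
by rewrite -mulrN -invrN opprB divr_ge0 ?subr_ge0 ?h1 ?ltW.
Qed.
End Oscillating.

(** * Frequencies independent over the integers *)

Section Frequencies.
Variable R : realType.

(** A telescoping majorant of D / (j + 1)!, which gives the remainders of the
    factorial series. *)
Definition fact_gap (D : R) j := 2 * D / j.+1`!%:R - 2 * D / j.+2`!%:R.

Lemma fact_gapE D j : fact_gap D j = 2 * D * (1 - j.+2%:R^-1) / j.+1`!%:R.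
Proof. by rewrite /fact_gap [j.+2`!]factS natrM invfM -mulrA mulrA; ring. Qed.

Lemma fact_gap_ge D j : 0 <= D -> D / j.+1`!%:R <= fact_gap D j.
Proof.
move=> D0; rewrite fact_gapE ler_pM2r ?invr_gt0 ?ltr0n ?fact_gt0 //.
have h : (j.+2%:R^-1 : R) <= 2^-1 by rewrite lef_pV2 ?posrE // ler_nat.
have : 0 <= D * (2^-1 - j.+2%:R^-1) by rewrite mulr_ge0 // subr_ge0.
by move: (j.+2%:R^-1) => r; rewrite !mulrBr; lra.
Qed.

Lemma fact_gap_sum D k :
  series (fact_gap D) k = 2 * D / 1`!%:R - 2 * D / k.+1`!%:R.
Proof.
pose u j := 2 * D / j.+1`!%:R.
rewrite seriesEnat /= -[RHS]opprB -(telescope_sumr u (leq0n k)) -sumrN.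
by apply: eq_bigr => i _; rewrite opprB.
Qed.

Lemma fact_gap_cvg D : 0 <= D ->
  series (fact_gap D) k @[k --> \oo] --> 2 * D / 1`!%:R.
Proof.
move=> D0; have uc : 2 * D / k.+1`!%:R @[k --> \oo] --> 0.
  apply: (@squeeze_cvgr _ _ _ _ (fun=> 0) (fun k => 2 * D * harmonic k)).
  - apply: nearW => k; rewrite divr_ge0 ?mulr_ge0 //=.
    rewrite ler_wpM2l ?mulr_ge0 // lef_pV2 ?posrE ?ltr0n ?fact_gt0 //.
    by rewrite ler_nat factS leq_pmulr // fact_gt0.
  - exact: cvg_cst.
  - rewrite -(mulr0 (2 * D)); apply: cvgM; first exact: cvg_cst.
    exact: cvg_harmonic.
have h : 2 * D / 1`!%:R - 2 * D / k.+1`!%:R @[k --> \oo] -->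
    2 * D / 1`!%:R - 0 by apply: cvgB => //; exact: cvg_cst.
rewrite subr0 in h; apply: cvg_trans h; apply: near_eq_cvg.
by apply: nearW => k; rewrite fact_gap_sum.
Qed.

Lemma is_cvg_fact_gap D : 0 <= D -> cvgn (series (fact_gap D)).
Proof. by move=> D0; apply/cvg_ex; eexists; exact: fact_gap_cvg. Qed.

Lemma fact_gap_tail D n : 0 <= D ->
  limn (series (fact_gap D)) - series (fact_gap D) n = 2 * D / n.+1`!%:R.
Proof.
move=> D0; rewrite (cvg_lim _ (fact_gap_cvg D0)) // fact_gap_sum.
by rewrite opprB addrC subrK.
Qed.

(** The argument for the irrationality of e: n! times the n-th partial sum is an
    integer Q n, equal to minus the n-th remainder times n!, which is less than 1
    in absolute value for large n.  Two consecutive vanishing partial sums then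
    give a vanishing digit. *)
Lemma factorial_series_eq0 (d : nat -> int) (D : nat) :
  (forall j, (`|d j| <= D)%N) ->
  limn (series (fun j => (d j)%:~R / j.+1`!%:R : R)) = 0 ->
  forall n, (2 * D <= n)%N -> d n = 0.
Proof.
move=> dD lim0.
pose Q := fix Q n : int := if n is m.+1 then m.+1%:Z * Q m + d m else 0.
have f0 k : (k`!%:R : R) != 0 by rewrite pnatr_eq0 -lt0n fact_gt0.
have QE n : series (fun j => (d j)%:~R / j.+1`!%:R : R) n = (Q n)%:~R / n`!%:R.
  elim: n => [|n IH]; first by rewrite seriesEnat /= big_geq // mul0r.
  rewrite seriesEnat /= big_nat_recr //=; move: IH; rewrite seriesEnat /= => ->.
  rewrite factS natrM intrD intrM mulrDl; congr (_ + _).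
  have n0 : (n.+1%:R : R) != 0 by rewrite pnatr_eq0.
  rewrite -pmulrn; move: n0 (f0 n); move: (n.+1%:R) (n`!%:R) => p q p0 q0.
  by field; rewrite p0 q0.
have Q0 n : (2 * D <= n)%N -> Q n = 0.
  move=> Dn; have D0 : 0 <= D%:R :> R by [].
  have := @series_tail_dominated R (fun j => (d j)%:~R / j.+1`!%:R) _ n _
    (is_cvg_fact_gap D0).
  rewrite fact_gap_tail // lim0 QE sub0r normrN => /(_ _)/wrap[].
    move=> j; apply: le_trans (fact_gap_ge j D0).
    rewrite normrM normfV (ger0_norm (ler0n _ _)).
    rewrite ler_pM2r ?invr_gt0 ?ltr0n ?fact_gt0 //.
    by rewrite -intr_norm -natr_absz ler_nat.
  rewrite normrM normfV (ger0_norm (ler0n _ _)).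
  rewrite factS natrM invfM mulrA ler_pM2r ?invr_gt0 ?ltr0n ?fact_gt0 //.
  rewrite -intr_norm -natr_absz ler_pdivlMr // -!natrM ler_nat => h.
  by apply/eqP; rewrite -absz_eq0; nia.
move=> n Dn; have := Q0 n.+1 (leqW Dn).
by rewrite /= Q0 // mulr0 add0r.
Qed.

Definition prefix_code (x : nat -> bool) n := pickle (mkseq x n).

Definition prefix_digit (x : nat -> bool) j : bool :=
  `[< exists n, j = prefix_code x n >].

(** The digits of x are the indicator of the set of codes of its prefixes; these
    sets are infinite and almost disjoint for distinct x. *)
Definition frequency (x : nat -> bool) : R :=
  limn (series (fun j => (prefix_digit x j)%:R / j.+1`!%:R : R)).

Lemma cvg_frequency x :
  cvgn (series (fun j => (prefix_digit x j)%:R / j.+1`!%:R : R)).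
Proof.
apply: (cvg_series_dominated _ (is_cvg_fact_gap ler01)) => j.
rewrite ger0_norm; last by rewrite divr_ge0.
apply: le_trans (fact_gap_ge j ler01).
by rewrite ler_pM2r ?invr_gt0 ?ltr0n ?fact_gt0 // lern1 leq_b1.
Qed.

Lemma prefix_code_inj x x' n n' : prefix_code x n = prefix_code x' n' ->
  n = n' /\ forall p, (p < n)%N -> x p = x' p.
Proof.
move=> /(pcan_inj pickleK) E.
have nn : n = n' by rewrite -(size_mkseq x n) E size_mkseq.
split=> // p pn; have := congr1 (fun s => nth false s p) E.
by rewrite !nth_mkseq -?nn.
Qed.

Lemma injective_unbounded (g : nat -> nat) : injective g ->
  forall A N, exists2 n, (N <= n)%N & (A <= g n)%N.
Proof.
move=> ginj A N; apply: contrapT => h.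
have sub : {subset map g (iota N A.+1) <= iota 0 A}.
  move=> _ /mapP[n + ->]; rewrite !mem_iota add0n /= => /andP[Nn _].
  by rewrite ltnNge; apply/negP => An; apply: h; exists n.
have := uniq_leq_size _ sub; rewrite map_inj_uniq // iota_uniq => /(_ isT).
by rewrite size_map !size_iota ltnn.
Qed.

(** The difference of the two sides is a factorial series with bounded integral
    digits.  At the code of a long prefix of x i, which is a prefix of no other
    x l, the digit is m i - m' i; such codes are arbitrarily large. *)
Lemma frequency_indep k (x : 'I_k -> nat -> bool) (m m' : 'I_k -> nat) :
  injective x ->
  \sum_i (m i)%:R * frequency (x i) = \sum_i (m' i)%:R * frequency (x i) ->
  m =1 m'.
Proof.
move=> xinj E i.
pose c l : int := (m l)%:Z - (m' l)%:Z.
pose d j : int := \sum_l c l * (prefix_digit (x l) j)%:Z.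
pose D := (\sum_l `|c l|)%N.
have dD j : (`|d j| <= D)%N.
  rewrite /d /D; elim/big_ind2 : _ => // [a a' b b' ha hb|l _]; first lia.
  by rewrite abszM; case: prefix_digit; rewrite ?muln1 ?muln0.
have lim0 : limn (series (fun j => (d j)%:~R / j.+1`!%:R : R)) = 0.
  apply: cvg_lim => //.
  have -> : 0 = \sum_l (c l)%:~R * frequency (x l) :> R.
    apply/esym/eqP; under eq_bigr do rewrite /c intrB mulrBl.
    by rewrite sumrB subr_eq0; apply/eqP.
  rewrite (_ : series _ = fun n => \sum_l (c l)%:~R *
      series (fun j => (prefix_digit (x l) j)%:R / j.+1`!%:R : R) n).
    apply: cvg_big => [|l _]; first exact: add_continuous.
    by apply: cvgM; [exact: cvg_cst | exact: cvg_frequency].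
  apply/funext => n; rewrite seriesEnat /=.
  under [RHS]eq_bigr do rewrite seriesEnat /= mulr_sumr.
  rewrite exchange_big /=; apply: eq_bigr => j _.
  rewrite /d rmorph_sum /= mulr_suml; apply: eq_bigr => l _.
  by rewrite intrM mulrA.
have [N NP] : exists N, forall l n, (N <= n)%N -> l != i ->
    exists2 p, (p < n)%N & x i p <> x l p.
  have /choice [p pP] l : exists p, l != i -> x i p <> x l p.
    have [ex|h] := pselect (exists p, l != i -> x i p <> x l p).
      exact: ex.
    have /eqP : l != i by apply/negP => li; apply: h; exists 0%N; rewrite li.
    case; apply: xinj; apply/funext => p; apply: contrapT => hp.
    by apply: h; exists p => _ /esym.
  exists (\max_l p l).+1 => l n Nn li; exists (p l); last exact: pP.
  by apply: leq_trans Nn; rewrite ltnS leq_bigmax.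
have cinj : injective (prefix_code (x i)) by move=> n n' /prefix_code_inj[].
have [n Nn Dn] := injective_unbounded cinj (2 * D) N.
have := factorial_series_eq0 dD lim0 Dn.
rewrite /d (bigD1 i) //= big1 => [|l li].
  rewrite addr0 (_ : prefix_digit _ _ = true); last by apply/asboolP; exists n.
  by rewrite mulr1 /c => /eqP; rewrite subr_eq0 => /eqP[].
rewrite (_ : prefix_digit _ _ = false) ?mulr0 //.
apply/asboolPn => -[n' /prefix_code_inj[_ h]].
by have [p pn] := NP l n Nn li; apply; exact: h.
Qed.

Lemma frequency_inj : injective frequency.
Proof.
move=> x x' E; apply: contrapT => xx'.
pose z (i : 'I_2) := if i == ord0 then x else x'.
have zinj : injective z.
  move=> [[|[|//]] i] [[|[|//]] j]; rewrite /z /= => h; apply/val_inj => //=.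
  by case: (xx' (esym h)).
have := @frequency_indep 2 z (fun i => (i == ord0)%N) (fun i => (i != ord0)%N)
  zinj.
rewrite !big_ord_recl !big_ord0 /z /= E !mul1r !mul0r !addr0 add0r.
by move=> /(_ erefl ord0).
Qed.

End Frequencies.

(** * Exponential sums *)

Section ExponentialSums.
Variables (R : realType) (I : eqType).
Implicit Types (s : seq I) (c theta : I -> R).

Definition expsum s c theta (t : R) := \sum_(i <- s) c i * expR (theta i * t).

Lemma is_derive_expsum s c theta (t : R) :
  is_derive t 1 (expsum s c theta) (expsum s (fun i => c i * theta i) theta t).
Proof.
elim: s => [|i s IH].
  rewrite (_ : expsum [::] c theta = cst 0).
    by rewrite /expsum big_nil; exact: is_derive_cst.
  by apply/funext => u; rewrite /expsum big_nil.
have -> : expsum (i :: s) c theta =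
    (c i *: (expR \o (theta i *: id))) + expsum s c theta.
  by apply/funext => u; rewrite /expsum big_cons.
rewrite {2}/expsum big_cons; apply: is_deriveD.
rewrite -mulrA; apply: is_deriveZ.
rewrite mulrC; apply: is_derive1_comp.
by rewrite -[X in is_derive _ _ _ X]mulr1; apply: is_deriveZ.
Qed.

Lemma derive1_expsum s c theta :
  derive1 (expsum s c theta) = expsum s (fun i => c i * theta i) theta.
Proof.
apply/funext => t; rewrite derive1E.
by have h := is_derive_expsum s c theta t; exact: derive_val.
Qed.

(** Dividing by the first exponential and differentiating removes one term and
    multiplies the other coefficients by differences of exponents, which are not
    zero. *)
Lemma expsum_eq0 s c theta (a b : R) :
  a < b -> uniq s -> {in s &, injective theta} ->
  (forall t, a < t < b -> expsum s c theta t = 0) -> {in s, forall i, c i = 0}.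
Proof.
move=> ab; elim: s c => // i0 s IH c /= /andP[i0s us] inj h0.
have inj_s : {in s &, injective theta}.
  by move=> i j is_ js; apply: inj; rewrite inE ?is_ ?js orbT.
have c0 : {in s, forall i, c i = 0}.
  pose dtheta i := theta i - theta i0.
  move=> i is_; have := IH (fun i => c i * dtheta i) us inj_s _ i is_.
  move=> /(_ _)/wrap[].
    move=> t tab.
    have E : expsum s (fun i => c i * dtheta i) dtheta t = 0.
      have shift u : expsum (i0 :: s) c dtheta u =
          expR (- theta i0 * u) * expsum (i0 :: s) c theta u.
        rewrite /expsum mulr_sumr; apply: eq_bigr => j _.
        by rewrite mulrCA -expRD /dtheta; congr (_ * expR _); ring.
      have := is_derive_slope_cvg (is_derive_expsum (i0 :: s) c dtheta t).
      have d0 : dtheta i0 = 0 by exact: subrr.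
      rewrite [X in _ --> X]/expsum big_cons d0 mulr0 mul0r add0r => h.
      rewrite -[LHS](cvg_lim _ h) //; apply: cvg_lim => //.
      apply: cvg_near_cst; apply: nbhs_dnbhs.
      apply: filterS (near_in_itvoo _) => [z|]; last exact: tab.
      by rewrite in_itv /= => zab; rewrite !shift !h0 // !mulr0 subrr mul0r.
    rewrite -(mulr0 (expR (theta i0 * t))) -E /expsum mulr_sumr.
    apply: eq_bigr => j _.
    by rewrite mulrCA -expRD /dtheta; congr (_ * expR _); ring.
  move=> /eqP; rewrite mulf_eq0 => /orP[/eqP //|].
  rewrite subr_eq0 => /eqP /inj.
  rewrite !inE eqxx is_ orbT => /(_ isT isT) ii0.
  by rewrite -ii0 is_ in i0s.
move=> i; rewrite inE => /predU1P[->|]; last exact: c0.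
have := h0 ((a + b) / 2); rewrite /expsum big_cons big_seq big1;
  last by move=> j js; rewrite c0 // mul0r.
rewrite addr0 => /(_ _)/wrap[]; first lra.
by move=> /eqP; rewrite mulf_eq0 (gt_eqF (expR_gt0 _)) orbF => /eqP.
Qed.

Lemma expsum_oscillating s c theta f : oscillating f -> uniq s ->
  {in s &, injective theta} ->
  (exists2 i, i \in s & c i * theta i != 0) ->
  oscillating (expsum s c theta \o f).
Proof.
move=> fosc us inj [i is_ ci]; apply: oscillating_comp => //.
- by move=> t; have [? _] := is_derive_expsum s c theta t.
- rewrite derive1_expsum => t; apply/differentiable_continuous/derivable1_diffP.
  by have [? _] := is_derive_expsum s (fun i => c i * theta i) theta t.
move=> a b ab; rewrite derive1_expsum; apply: contrapT => h.
move/eqP: ci; apply.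
apply: (@expsum_eq0 s (fun i => c i * theta i) _ _ _ ab us inj) is_ => t tab.
by apply: contrapT => /eqP ht; apply: h; exists t.
Qed.

End ExponentialSums.

Theorem theorem4p12 (R : realType) :
  strongly_algebrable continuum (DNM (R := R)).
Proof.
have [f fosc] := oscillating_exists R.
pose gen (x : nat -> bool) (t : unit_interval R) : R :=
  expR (frequency R x * f (val t)).
have zero01 : (0 : R) \in `[0 : R, 1]%classic.
  by rewrite inE /= in_itv /= lexx ler01.
have one01 : (1 : R) \in `[0 : R, 1]%classic.
  by rewrite inE /= in_itv /= ler01 lexx.
pose o0 : unit_interval R := exist _ 0 zero01.
pose o1 : unit_interval R := exist _ 1 one01.
have not0 (h : unit_interval R -> R) : DNM (R := R) h -> exists t, h t != 0.
  move=> [_ /(_ o0 o1)]; rewrite ltr_val /= => /(_ ltr01) nm.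
  apply: contrapT => h0; apply: nm; left => u v _ _ _.
  have z w : h w = 0 by apply: contrapT => /eqP hw; apply: h0; exists w.
  by rewrite !z.
have gen_inj : injective gen.
  move=> x x' E; apply: (@frequency_inj R).
  have [t ft] := not0 _ (oscillating_DNM fosc).
  have /expR_inj := congr1 (fun g => g t) E.
  exact: mulIf.
exists (range gen); split.
  by apply: inj_card_eq => x x' _ _; exact: gen_inj.
move=> k P y k0 P0 Pc yinj yX.
have /choice [x xE] i : exists x, gen x = y i.
  by have [x _ <-] := yX i; exists x.
have xinj : injective x by move=> i j ij; apply: yinj; rewrite -!xE ij.
pose theta (m : multinom k) : R := \sum_i (m i)%:R * frequency R (x i).
have theta_inj : injective theta.
  by move=> m m' /(frequency_indep xinj) mm'; apply/mnmP.
have evalE : algebra_eval y P =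
    (expsum (msupp P) (fun m => mcoeff m P) theta \o f) \o val.
  apply/funext => t; rewrite /algebra_eval /mmap fct_sumE /= /expsum.
  apply: eq_bigr => m _; rewrite -[LHS]/(mcoeff m P * 1 * mmap1 y m t) mulr1.
  congr (_ * _); rewrite /theta mulr_suml expR_sum /mmap1.
  have prodE (J : seq 'I_k) (F : 'I_k -> unit_interval R -> R) :
    (\prod_(i <- J) F i) t = \prod_(i <- J) F i t.
    by elim: J => [|j J IH]; rewrite ?big_nil // !big_cons -IH.
  rewrite prodE; apply: eq_bigr => i _.
  have expE (F : unit_interval R -> R) n : (F ^+ n) t = F t ^+ n.
    by elim: n => // n IH; rewrite !exprS -IH.
  by rewrite expE -xE /gen -expRM_natl mulrA.
have osc : DNM (R := R) (algebra_eval y P).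
  rewrite evalE; apply: oscillating_DNM; apply: expsum_oscillating => //.
  - by move=> m m' _ _; exact: theta_inj.
  (* Any monomial of P will do: it is not constant, so its exponent is nonzero. *)
  have : msupp P != [::] by rewrite msupp_eq0.
  case E : (msupp P) => [//|m s] _; exists m; first exact: mem_head.
  have mP : mcoeff m P != 0 by rewrite -mcoeff_msupp E mem_head.
  rewrite mulf_neq0 //; apply: contra_neq mP => t0.
  suff -> : m = mnm0 by [].
  apply: theta_inj; rewrite t0 /theta big1 // => i _.
  by rewrite mnm0E mul0r.
split=> //; have [t ht] := not0 _ osc.
by apply: contra_neq ht => ->.
Qed.
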